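(* Let $R$ be an augmented Noetherian semiperfect algebra with Jacobson radical $J$ and let $$\xi:\quad 0\to K\to M\to N\to 0$$ be a short exact sequence in the category $\mathcal{C}$ (i.e. a short exact sequence of $R$-modules with $K,M,N\in\mathcal{C}$). Then the following statements are true: (1) If $\mathcal{C}$ is the category of quasi-Koszul modules, then $JK=K\cap JM$ if and only if the minimal Horseshoe Lemma holds with respect to $\xi$. (2) If $\mathcal{C}$ is the category of quasi-$d$-Koszul modules, then $JK=K\cap JM$ if and only if the minimal Horseshoe Lemma holds with respect to $\xi$. (3) If $\mathcal{C}$ is the category of quasi-piecewise-Koszul modules, then $JK=K\cap JM$ if and only if the minimal Horseshoe Lemma holds with respect to $\xi$.
   Context: Modules are left modules. $R$ is an associative unital algebra over a field. Semiperfect means every finitely generated $R$-module has a (finitely generated) projective cover. Augmented means that the canonical projection $R\to R/J$ is split by an algebra homomorphism $R/J\to R$. Given an exact sequence, $K$ is regarded as a submodule of $M$. A projective resolution $\cdots\to P_1\xrightarrow{d_1}P_0\xrightarrow{d_0}M\to 0$ is minimal if $P_0\to M$ and each $P_n\to \ker d_{n-1}$ ($n\ge1$) are projective covers. For a strictly increasing function $\delta:\mathbb{N}\to\mathbb{N}$, a finitely generated $R$-module $M$ is quasi-$\delta$-Koszul if, for a minimal projective resolution $\cdots\to P_n\xrightarrow{d_n}\cdots\to P_0\xrightarrow{d_0}M\to0$, for all $n\ge0$ one has $\ker d_n\subseteq J^{\delta(n+1)-\delta(n)}P_n$ and $J\ker d_n=\ker d_n\cap J^{\delta(n+1)-\delta(n)+1}P_n$.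 Quasi-Koszul modules are the quasi-$\delta$-Koszul modules with $\delta(n)=n$. Quasi-$d$-Koszul modules (for a fixed integer $d\ge2$) are those with $\delta(n)=\frac{nd}{2}$ for $n$ even and $\delta(n)=\frac{(n-1)d}{2}+1$ for $n$ odd. Quasi-piecewise-Koszul modules (for fixed integers $d\ge p\ge2$) are those with $\delta(n)=\frac{(n-r)d}{p}+r$ whenever $n\equiv r \pmod p$, $0\le r\le p-1$. The minimal Horseshoe Lemma holds with respect to $\xi: 0\to K\to M\to N\to0$ if for any given minimal projective resolutions $\mathcal{P}_*\to K\to0$ and $\mathcal{Q}_*\to N\to0$ there are a minimal projective resolution $\mathcal{L}_*\to M\to 0$ and a short exact sequence of complexes $0\to\mathcal{P}_*\to\mathcal{L}_*\to\mathcal{Q}_*\to0$ such that the resulting diagram over $\xi$ (with the augmentations to $K$, $M$, $N$) is commutative with exact rows and columns. *)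

(* Defs.v *)
From mathcomp Require Import all_boot all_order all_algebra.
From mathcomp Require Import boolp classical_sets.
From mathcomp Require Import zify.

Set Implicit Arguments.
Unset Strict Implicit.
Unset Printing Implicit Defensive.

Import GRing.Theory.
Local Open Scope ring_scope.
Local Open Scope classical_set_scope.

Section Modules.
Variable R : nzRingType.
Implicit Types K M N P X : lmodType R.

Definition submodule M (A : set M) : Prop := GRing.submod_closed (mem A).

Definition finitely_generated M (A : set M) : Prop :=
  exists (n : nat) (v : 'I_n -> M),
    A = [set x | exists c : 'I_n -> R, x = \sum_(i < n) c i *: v i].

(* The product of a set of scalars with a subset of a module: all finite sums
   of products. *)
Definition smul M (I : set R) (A : set M) : set M :=
  [set x | exists (n : nat) (a : 'I_n -> R) (v : 'I_n -> M),
     [/\ forall i, I (a i), forall i, A (v i) & x = \sum_(i < n) a i *: v i]].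

(* Left ideals are the submodules of the left regular module R^o. *)
Definition maximal_left_ideal (I : set R^o) : Prop :=
  [/\ submodule I, I <> setT &
      forall I' : set R^o, submodule I' -> I `<=` I' -> I' = I \/ I' = setT].

Definition jacobson : set R :=
  [set a | forall I : set R^o, maximal_left_ideal I -> I a].

Fixpoint jacobson_exp (n : nat) : set R :=
  if n is m.+1 then @smul R^o jacobson (jacobson_exp m) else setT.

Definition noetherian : Prop :=
  forall I : set R^o, submodule I -> finitely_generated I.

Definition ker X M (f : {linear X -> M}) : set X := f @^-1` [set 0].

Definition short_exact M1 M2 M3
    (f : {linear M1 -> M2}) (g : {linear M2 -> M3}) : Prop :=
  [/\ injective f, range f = ker g & range g = setT].

Definition projective P : Prop :=
  forall M N (g : {linear M -> N}) (h : {linear P -> N}),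
    range g = setT -> exists l : {linear P -> M}, g \o l =1 h.

Definition superfluous M (A : set M) : Prop :=
  forall B : set M, submodule B ->
    [set a + b | a in A & b in B] = setT -> B = setT.

(* The corestriction of p to the submodule A of M is a projective cover of A;
   with A = setT, p is a projective cover of M. *)
Definition projective_cover_onto P M (p : {linear P -> M}) (A : set M) : Prop :=
  [/\ projective P, range p = A & superfluous (ker p)].

Definition semiperfect : Prop :=
  forall M, finitely_generated [set: M] ->
    exists (P : lmodType R) (p : {linear P -> M}),
      finitely_generated [set: P] /\ projective_cover_onto p setT.

(* A sequence of modules and maps ... -> P_1 -> P_0 -> M: [diff n] is the map
   d_{n+1} : P_{n+1} -> P_n and [aug] is d_0 : P_0 -> M.  No exactness is
   required here; it is part of [minimal_resolution]. *)
Record augmented_sequence (M : lmodType R) := AugmentedSequence {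
  term : nat -> lmodType R;
  diff : forall n, {linear term n.+1 -> term n};
  aug : {linear term 0%N -> M} }.

Arguments term {M} _ n.
Arguments diff {M} _ n.
Arguments aug {M} _.

(* The submodule ker d_n of P_n. *)
Definition syzygy M (P : augmented_sequence M) (n : nat) : set (term P n) :=
  match n return set (term P n) with
  | 0%N => ker (aug P)
  | m.+1 => ker (diff P m)
  end.
Arguments syzygy {M} P n.

(* The range condition in each projective cover gives exactness. *)
Definition minimal_resolution M (P : augmented_sequence M) : Prop :=
  projective_cover_onto (aug P) setT /\
  forall n, projective_cover_onto (diff P n) (syzygy P n).

(* Intended for strictly increasing delta, so that the subtraction on nat is
   never truncated. *)
Definition quasi_delta_koszul (delta : nat -> nat) M : Prop :=
  finitely_generated [set: M] /\
  exists P : augmented_sequence M, minimal_resolution P /\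
    forall n, let e := (delta n.+1 - delta n)%N in
      syzygy P n `<=` smul (jacobson_exp e) setT /\
      smul jacobson (syzygy P n)
        = syzygy P n `&` smul (jacobson_exp e.+1) setT.

Definition delta_d (d n : nat) : nat :=
  if odd n then (((n - 1) * d) %/ 2 + 1)%N else ((n * d) %/ 2)%N.

Definition delta_piecewise (p d n : nat) : nat :=
  let r := (n %% p)%N in (((n - r) * d) %/ p + r)%N.

Definition quasi_koszul M : Prop := quasi_delta_koszul (fun n => n) M.
Definition quasi_d_koszul (d : nat) M : Prop :=
  quasi_delta_koszul (delta_d d) M.
Definition quasi_piecewise_koszul (p d : nat) M : Prop :=
  quasi_delta_koszul (delta_piecewise p d) M.

Definition minimal_horseshoe K M N
    (f : {linear K -> M}) (g : {linear M -> N}) : Prop :=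
  forall (P : augmented_sequence K) (Q : augmented_sequence N),
    minimal_resolution P -> minimal_resolution Q ->
    exists L : augmented_sequence M, minimal_resolution L /\
    exists (i : forall n, {linear term P n -> term L n})
           (q : forall n, {linear term L n -> term Q n}),
      [/\ forall n, short_exact (i n) (q n),
          forall n, i n \o diff P n =1 diff L n \o i n.+1,
          forall n, q n \o diff L n =1 diff Q n \o q n.+1,
          f \o aug P =1 aug L \o i 0%N &
          g \o aug L =1 aug Q \o q 0%N].

End Modules.

Arguments jacobson : clear implicits.
Arguments term {R M} _ n.
Arguments diff {R M} _ n.
Arguments aug {R M} _.
Arguments syzygy {R M} P n _.

(* The quotient algebra R/J and its projection are given up to isomorphism, by
   a surjective algebra homomorphism pi with kernel J. *)
Definition augmented (k : fieldType) (R : algType k) : Prop :=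
  exists (S : algType k) (pi : {lrmorphism R -> S}) (s : {lrmorphism S -> R}),
    [/\ range pi = setT, pi @^-1` [set 0] = jacobson R & cancel s pi].

Lemma delta_d_mono (d : nat) :
  (2 <= d)%N -> {homo delta_d d : m n / (m < n)%N}.
Proof.
move=> d2; apply: (homo_ltn ltn_trans) => n; rewrite /delta_d /=.
rewrite -[n]odd_double_half; case: (odd n) => /=; rewrite ?odd_double /=.
  have -> : (1 + n./2.*2 - 1)%N = (n./2 * 2)%N by lia.
  have -> : (1 + n./2.*2).+1 = (n./2.+1 * 2)%N by lia.
  by rewrite -!mulnA ![(2 * d)%N]mulnC !mulnA !mulnK //; nia.
have -> : ((0 + n./2.*2).+1 - 1)%N = (n./2 * 2)%N by lia.
by rewrite add0n -muln2 addn1.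
Qed.

Lemma delta_piecewise_mono (p d : nat) :
  (2 <= p <= d)%N -> {homo delta_piecewise p d : m n / (m < n)%N}.
Proof.
move=> /andP[p2 pd].
have E n : delta_piecewise p d n = (n %/ p * d + n %% p)%N.
  rewrite /delta_piecewise {1}[n](divn_eq n p) addnK mulnAC mulnK //; lia.
apply: (homo_ltn ltn_trans) => n; rewrite !E.
have r_lt : (n %% p < p)%N by rewrite ltn_mod; lia.
have [rS|rS] := ltnP (n %% p).+1 p.
  have nS : n.+1 = (n %/ p * p + (n %% p).+1)%N by rewrite addnS -divn_eq.
  rewrite nS divnMDl ?modnMDl; last lia.
  by rewrite (divn_small rS) (modn_small rS) addn0; lia.
have nS : n.+1 = ((n %/ p).+1 * p)%N by rewrite [in LHS](divn_eq n p); lia.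
by rewrite nS mulnK ?modnMl; nia.
Qed.

(* Main.v *)
(* If L is a minimal resolution of M extending one of N by one P of K, then an
   element of K meeting JM lifts to J L_0.  As the sequence of first syzygies is
   exact and syzygies lie in the radical, the lift can be moved into P_0, hence
   into J P_0 since 0 -> P_0 -> L_0 -> Q_0 -> 0 splits.

   Conversely, JK = K meet JM makes P_0 + Q_0 -> M a projective cover, by
   Nakayama.  Write K1 and M1 for the first syzygies of K and M.  The Koszul
   conditions say J K1 = K1 meet J^e P_0 and J M1 = M1 meet J^e (P_0 + Q_0) with
   the same e, so J K1 = K1 meet J M1 and the construction can be iterated.  The
   condition on M is given on some minimal resolution, and is transported to the
   one under construction by uniqueness of projective covers. *)
From HB Require Import structures.
Require Import Defs.
From mathcomp Require Import all_boot all_order all_algebra.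
From mathcomp Require Import boolp classical_sets.

Set Implicit Arguments.
Unset Strict Implicit.
Unset Printing Implicit Defensive.

Import GRing.Theory.
Local Open Scope ring_scope.
Local Open Scope classical_set_scope.

(** * Linear maps out of and into direct sums, and out of free modules *)

Section LinearMaps.
Variable R : nzRingType.
Implicit Types K M N P Q X : lmodType R.

Definition copair P Q M (u : {linear P -> M}) (v : {linear Q -> M})
  (x : (P * Q)%type) : M := u x.1 + v x.2.

Lemma copair_is_linear P Q M (u : {linear P -> M}) (v : {linear Q -> M}) :
  linear (copair u v).
Proof. by move=> a x y; rewrite /copair /= !linearP scalerDr addrACA. Qed.

HB.instance Definition _ P Q M (u : {linear P -> M}) (v : {linear Q -> M}) :=
  GRing.isLinear.Build R (P * Q)%type M *:%R (copair u v)
    (copair_is_linear u v).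

Definition inl_mod P Q (x : P) : P * Q := (x, 0).

Lemma inl_mod_is_linear P Q : linear (@inl_mod P Q).
Proof. by move=> a x y; congr pair; rewrite /= scaler0 addr0. Qed.

HB.instance Definition _ P Q :=
  GRing.isLinear.Build R P (P * Q)%type *:%R (@inl_mod P Q)
    (@inl_mod_is_linear P Q).

Definition inr_mod P Q (x : Q) : P * Q := (0, x).

Lemma inr_mod_is_linear P Q : linear (@inr_mod P Q).
Proof. by move=> a x y; congr pair; rewrite /= scaler0 addr0. Qed.

HB.instance Definition _ P Q :=
  GRing.isLinear.Build R Q (P * Q)%type *:%R (@inr_mod P Q)
    (@inr_mod_is_linear P Q).

(** Coefficients are row vectors rather than functions, so that this is a linear map from the free
    module ['rV[R]_n]. *)
Definition lincomb M n (v : 'I_n -> M) (c : 'rV[R]_n) : M :=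
  \sum_(i < n) c 0 i *: v i.

Lemma lincomb_is_linear M n (v : 'I_n -> M) : linear (lincomb v).
Proof.
move=> a x y; rewrite /lincomb scaler_sumr -big_split /=.
by apply: eq_bigr => i _; rewrite !mxE scalerDl scalerA.
Qed.

HB.instance Definition _ M n (v : 'I_n -> M) :=
  GRing.isLinear.Build R 'rV[R]_n M *:%R (lincomb v) (lincomb_is_linear v).

End LinearMaps.

Arguments inl_mod {R P Q}.
Arguments inr_mod {R P Q}.

(** * Submodules, finite generation and products with sets of scalars *)

Section Submodules.
Variable R : nzRingType.
Implicit Types K M N P Q X : lmodType R.
Implicit Types I : set R.

Lemma submoduleP M (A : set M) :
  submodule A <-> A 0 /\ forall a u v, A u -> A v -> A (a *: u + v).
Proof.
split=> -[A0 AD]; split.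
- by move: A0; rewrite in_setE.
- by move=> a u v Au Av; have := AD a u v; rewrite !in_setE; apply.
- by rewrite in_setE.
- by move=> a u v; rewrite !in_setE; apply: AD.
Qed.

Section Closure.
Variables (M : lmodType R) (A : set M).
Hypothesis subA : submodule A.

Lemma submod0 : A 0. Proof. by case/submoduleP: subA. Qed.

Lemma submodD u v : A u -> A v -> A (u + v).
Proof. by case/submoduleP: subA => _ /(_ 1 u v); rewrite scale1r. Qed.

Lemma submodZ a u : A u -> A (a *: u).
Proof.
case/submoduleP: subA => A0 /(_ a u 0) AD Au.
by have := AD Au A0; rewrite addr0.
Qed.

Lemma submodN u : A u -> A (- u).
Proof. by move=> Au; rewrite -scaleN1r; apply: submodZ. Qed.

Lemma submodB u v : A u -> A v -> A (u - v).
Proof. by move=> Au /submodN; apply: submodD. Qed.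

Lemma submod_sum n (a : 'I_n -> R) (v : 'I_n -> M) :
  (forall i, A (v i)) -> A (\sum_(i < n) a i *: v i).
Proof.
by move=> Av; elim/big_ind: _ => [|x y|i _];
  [apply: submod0 | apply: submodD | apply/submodZ/Av].
Qed.

End Closure.

Lemma submoduleT M : submodule [set: M].
Proof. by apply/submoduleP. Qed.

Lemma submodule_preimage M N (f : {linear M -> N}) (B : set N) :
  submodule B -> submodule (f @^-1` B).
Proof.
move=> subB; apply/submoduleP; split=> [|a u v]; rewrite /preimage /=.
  by rewrite linear0; apply: submod0.
by rewrite linearP => Bu Bv; apply: submodD => //; apply: submodZ.
Qed.

Lemma submodule_image M N (f : {linear M -> N}) (A : set M) :
  submodule A -> submodule (f @` A).
Proof.
move=> subA; apply/submoduleP; split=> [|a _ _ [u Au <-] [v Av <-]].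
  by exists 0; [apply: submod0 | rewrite linear0].
exists (a *: u + v); last by rewrite linearP.
by apply: submodD => //; apply: submodZ.
Qed.

Lemma submodule_range M N (f : {linear M -> N}) : submodule (range f).
Proof. exact/submodule_image/submoduleT. Qed.

Lemma submodule_ker M N (f : {linear M -> N}) : submodule (ker f).
Proof.
apply: submodule_preimage; apply/submoduleP; split=> // a u v -> ->.
by rewrite scaler0 addr0.
Qed.

Lemma submodule_setI M (A B : set M) :
  submodule A -> submodule B -> submodule (A `&` B).
Proof.
move=> subA subB; apply/submoduleP; split=> [|a u v [Au Bu] [Av Bv]].
  by split; apply: submod0.
by split; apply: submodD => //; apply: submodZ.
Qed.

Lemma submodule_sum M (A B : set M) :
  submodule A -> submodule B -> submodule [set a + b | a in A & b in B].
Proof.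
move=> subA subB.
apply/submoduleP; split=> [|a _ _ [u Au [v Bv <-]] [u' Au' [v' Bv' <-]]].
  by exists 0; [|exists 0]; rewrite ?addr0 //; apply: submod0.
exists (a *: u + u'); first by apply: submodD => //; apply: submodZ.
exists (a *: v + v'); first by apply: submodD => //; apply: submodZ.
by rewrite scalerDr addrACA.
Qed.

Lemma finitely_generatedP M (A : set M) :
  finitely_generated A <->
  exists n (v : 'I_n -> M), A = range (lincomb v).
Proof.
split=> -[n [v ->]]; exists n, v; apply/seteqP; split=> x.
- case=> c ->; exists (\row_i c i) => //; rewrite /lincomb.
  by apply: eq_bigr => i _; rewrite mxE.
- by case=> c _ <-; exists (c 0).
- by case=> c _ <-; exists (c 0).
- case=> c ->; exists (\row_i c i) => //; rewrite /lincomb.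
  by apply: eq_bigr => i _; rewrite mxE.
Qed.

Lemma finitely_generated_image M N (f : {linear M -> N}) (A : set M) :
  finitely_generated A -> finitely_generated (f @` A).
Proof.
move=> /finitely_generatedP[n [v ->]]; apply/finitely_generatedP.
exists n, (f \o v).
have fE c : f (lincomb v c) = lincomb (f \o v) c.
  by rewrite linear_sum; apply: eq_bigr => i _; rewrite linearZ.
apply/seteqP; split=> [_ [_ [c _ <-] <-]|_ [c _ <-]]; first by exists c.
by exists (lincomb v c); [exists c|].
Qed.

Lemma finitely_generated_sum M (A B : set M) :
  finitely_generated A -> finitely_generated B ->
  finitely_generated [set a + b | a in A & b in B].
Proof.
move=> /finitely_generatedP[m [u ->]] /finitely_generatedP[n [v ->]].
apply/finitely_generatedP; exists (m + n)%N.
pose w i := match split i with inl j => u j | inr j => v j end.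
exists w.
have wE c d : lincomb w (row_mx c d) = lincomb u c + lincomb v d.
  rewrite /lincomb big_split_ord /=; congr (_ + _); apply: eq_bigr => i _.
    by rewrite row_mxEl /w (unsplitK (inl i)).
  by rewrite row_mxEr /w (unsplitK (inr i)).
apply/seteqP; split=> [_ [_ [c _ <-] [_ [d _ <-] <-]]|_ [c _ <-]].
  by exists (row_mx c d).
rewrite -[c]hsubmxK wE; exists (lincomb u (lsubmx c)).
  by exists (lsubmx c).
by exists (lincomb v (rsubmx c)); first by exists (rsubmx c).
Qed.

Lemma finitely_generated_pair P Q :
  finitely_generated [set: P] -> finitely_generated [set: Q] ->
  finitely_generated [set: (P * Q)%type].
Proof.
move=> fgP fgQ.
have -> : [set: (P * Q)%type] =
    [set x + y | x in inl_mod @` [set: P] & y in inr_mod @` [set: Q]].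
  apply/seteqP; split=> // -[x y] _.
  exists (inl_mod x); first by exists x.
  exists (inr_mod y); first by exists y.
  by congr pair; rewrite /= ?addr0 ?add0r.
by apply: finitely_generated_sum; apply: finitely_generated_image.
Qed.

(** Induction on the number of generators of a module containing [A]. The coefficients of the first
    generator that occur in elements of [A] form a left ideal, which is finitely generated;
    subtracting lifts of its generators leaves elements of [A] in the span of the other
    generators. *)
Lemma finitely_generated_submodule M (A : set M) :
  noetherian R -> finitely_generated [set: M] -> submodule A ->
  finitely_generated A.
Proof.
move=> noethR /finitely_generatedP[n [v Mv]] subA.
have {Mv} : A `<=` range (lincomb v) by rewrite -Mv.
elim: n v A subA => [|n IHn] v A subA Av.
  apply/finitely_generatedP; exists 0%N, v; apply/seteqP; split=> // _ [c _ <-].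
  by rewrite /lincomb big_ord0; apply: submod0.
pose W : set M := range (lincomb (v \o lift ord0)).
have subW : submodule W := submodule_range _.
pose I : set R^o := [set a | exists2 w, W w & A (a *: v ord0 + w)].
have /noethR/finitely_generatedP[k [u IE]] : submodule I.
  apply/submoduleP; split=> [|a b c [w Ww Aw] [w' Ww' Aw']].
    by exists 0; rewrite ?scale0r ?addr0; apply: submod0.
  exists (a *: w + w'); first by apply: submodD => //; apply: submodZ.
  rewrite scalerDl -scalerA addrACA -scalerDr.
  by apply: submodD => //; apply: submodZ.
have /choice[w wP] : forall i, exists w, W w /\ A (u i *: v ord0 + w).
  move=> i; have : I (u i).
    rewrite IE; exists (delta_mx 0 i) => //; rewrite /lincomb (bigD1 i) //=.
    rewrite mxE !eqxx scale1r big1 ?addr0 // => j ji.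
    by rewrite mxE (negbTE ji) andbF scale0r.
  by case=> w; exists w.
(* These elements of [A] realize the generators [u i] of [I] as leading coefficients. *)
pose x i := u i *: v ord0 + w i.
have -> : A = [set a + b | a in range (lincomb x) & b in A `&` W].
  apply/seteqP; split=> [a Aa|_ [_ [c _ <-] [b [Ab _] <-]]]; last first.
    by apply: submodD => //; apply: submod_sum => // i; case: (wP i).
  have [c _ cE] := Av a Aa.
  have aE : a = c 0 ord0 *: v ord0 +
      lincomb (v \o lift ord0) (\row_i c 0 (lift ord0 i)).
    rewrite -cE /lincomb big_ord_recl; congr (_ + _).
    by apply: eq_bigr => i _; rewrite mxE.
  have [d _ dE] : range (lincomb u) (c 0 ord0).
    rewrite -IE; exists (lincomb (v \o lift ord0) (\row_i c 0 (lift ord0 i))).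
      by eexists.
    by rewrite -aE.
  exists (lincomb x d); first by exists d.
  exists (a - lincomb x d); last by rewrite addrC subrK.
  split.
    by apply: submodB => //; apply: submod_sum => // i; case: (wP i).
  have -> : lincomb x d = c 0 ord0 *: v ord0 + \sum_(i < k) d 0 i *: w i.
    rewrite -dE /lincomb scaler_suml -big_split; apply: eq_bigr => i _ /=.
    by rewrite scalerDr scalerA.
  rewrite aE opprD addrACA subrr add0r; apply: submodB => //; first by eexists.
  by apply: submod_sum => // i; case: (wP i).
apply: finitely_generated_sum; first by apply/finitely_generatedP; exists k, x.
by apply: (IHn (v \o lift ord0)); [apply: submodule_setI|move=> ? []].
Qed.

Lemma smulS M I (A B : set M) : A `<=` B -> smul I A `<=` smul I B.
Proof.
by move=> AB x [n [a [v [Ia Av ->]]]]; exists n, a, v; split=> // i; apply: AB.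
Qed.

Lemma smulD M I (A : set M) x y : smul I A x -> smul I A y -> smul I A (x + y).
Proof.
move=> [m [a [u [Ia Au ->]]]] [n [b [v [Ib Bv ->]]]]; exists (m + n)%N.
exists (fun i => match split i with inl j => a j | inr j => b j end).
exists (fun i => match split i with inl j => u j | inr j => v j end).
split=> [i|i|]; try by case: (split i).
rewrite big_split_ord /=; congr (_ + _); apply: eq_bigr => i _.
  by rewrite (unsplitK (inl i)).
by rewrite (unsplitK (inr i)).
Qed.

Lemma smulN M I (A : set M) x : submodule A -> smul I A x -> smul I A (- x).
Proof.
move=> subA [m [a [u [Ia Au ->]]]]; exists m, a, (fun i => - u i).
split=> // [i|]; first exact: submodN.
by rewrite -sumrN; apply: eq_bigr => i _; rewrite scalerN.
Qed.

Lemma smulB M I (A : set M) x y :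
  submodule A -> smul I A x -> smul I A y -> smul I A (x - y).
Proof. by move=> subA Ax Ay; apply/smulD/smulN. Qed.

(** Read from right to left, this lifts an element of [I f(A)] to one of [I A], by choosing a
    preimage in [A] for each vector of the sum. *)
Lemma image_smul M N (f : {linear M -> N}) I (A : set M) :
  f @` smul I A = smul I (f @` A).
Proof.
apply/seteqP; split.
  move=> _ [_ [n [a [v [Ia Av ->]]]] <-].
  exists n, a, (f \o v); split=> // [i|]; first by exists (v i).
  by rewrite linear_sum; apply: eq_bigr => i _; rewrite linearZ.
move=> _ [n [a [w [Ia Aw ->]]]].
have /choice[v vE] : forall i, exists v, A v /\ f v = w i.
  by move=> i; have [v Av <-] := Aw i; exists v.
exists (\sum_(i < n) a i *: v i).
  by exists n, a, v; split=> // i; case: (vE i).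
rewrite linear_sum; apply: eq_bigr => i _; rewrite linearZ /=.
by have [_ ->] := vE i.
Qed.

Lemma linear_smul M N (f : {linear M -> N}) I (A : set M) (B : set N) x :
  (forall y, A y -> B (f y)) -> smul I A x -> smul I B (f x).
Proof.
move=> AB Ax; have : (f @` smul I A) (f x) by exists x.
by rewrite image_smul; apply: smulS => _ [y Ay <-]; apply: AB.
Qed.

End Submodules.

(** * Maximal left ideals, the Jacobson radical and Nakayama's lemma *)

Section Radical.
Variable R : nzRingType.
Implicit Types M P : lmodType R.
Local Notation J := (jacobson R).

Lemma maximal_left_ideal_exists (I : set R^o) :
  submodule I -> ~ I 1 ->
  exists m : set R^o, [/\ maximal_left_ideal m, I `<=` m & ~ m 1].
Proof.
move=> subI I1.
(* Zorn is applied to [X] through its union with [I], because the empty chain has union [set0],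
   which must be good too. *)
pose good (X : set R^o) := submodule (I `|` X) /\ ~ (I `|` X) 1.
have [F Fgood Ftot|X [[subX X1] Xmax]] := @Zorn_bigcup R^o good.
  split; last by case=> // -[X /Fgood[_]] + X1; apply; right.
  have chain u v : (I `|` \bigcup_(X in F) X) u ->
      (I `|` \bigcup_(X in F) X) v ->
      exists X, [/\ F X \/ X = set0, (I `|` X) u & (I `|` X) v].
    move=> [Iu|[X FX Xu]] [Iv|[Y FY Yv]].
    - by exists set0; split; [right|left|left].
    - by exists Y; split; [left|left|right].
    - by exists X; split; [left|right|left].
    - have [XY|YX] := Ftot X Y FX FY.
        by exists Y; split; [left|right; apply: XY|right].
      by exists X; split; [left|right|right; apply: YX].
  apply/submoduleP; split=> [|a u v Fu Fv]; first by left; apply: submod0.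
  have [X [FX Xu Xv]] := chain u v Fu Fv.
  have subIX : submodule (I `|` X).
    by case: FX => [/Fgood[]//|->]; rewrite setU0.
  have [Iw|Xw] : (I `|` X) (a *: u + v).
  - by apply: submodD => //; apply: submodZ.
  - by left.
  - by right; case: FX Xw => [FX Xw|-> //]; exists X.
exists (I `|` X); split=> //.
split=> // [E|B subB IB]; first by apply: X1; rewrite E.
have [B1|B1] := pselect (B 1).
  right; apply/seteqP; split=> // r _; rewrite -[r]mulr1.
  exact: (submodZ subB).
left; apply/seteqP; split=> //.
have /(_ B) := Xmax; rewrite /good.
have -> : I `|` B = B by apply/setUidPr => x Ix; apply: IB; left.
move=> nB; apply: contrapT => BX; apply: nB => //.
split; first by move=> x Xx; apply: IB; right.
by move=> BX'; apply: BX => x /BX'; right.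
Qed.

(** By maximality [m + R c] is the whole ring, so it contains [b]. *)
Lemma maximal_left_ideal_add (m : set R^o) (c b : R) :
  maximal_left_ideal m -> ~ m c -> exists d : R, m (b - d * c).
Proof.
move=> [subm _ mM] mc.
pose m' : set R^o := [set x + y | x in m & y in range (fun d : R => d * c)].
have mm' : m `<=` m'.
  move=> x mx; exists x => //; exists 0; last by rewrite addr0.
  by exists 0; rewrite ?mul0r.
have subm' : submodule m'.
  apply/submoduleP; split; first by apply: mm'; apply: (submod0 subm).
  move=> a _ _ [x mx [_ [d _ <-] <-]] [y my [_ [e _ <-] <-]].
  exists (a * x + y).
    by apply: (submodD subm) => //; apply: (submodZ subm).
  exists ((a * d + e) * c); first by exists (a * d + e).
  by rewrite mulrDl -(mulrA a) [LHS]addrACA -mulrDr.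
have [m'E|m'T] := mM m' subm' mm'.
  exfalso; apply: mc; rewrite -m'E; exists 0; first exact: (submod0 subm).
  by exists c; [exists 1; rewrite ?mul1r|rewrite add0r].
have [x mx [_ [d _ <-] E]] : m' b by rewrite m'T.
by exists d; rewrite -E addrK.
Qed.

(* For a maximal left ideal m and r not in m, the left ideal {a | a r in m} is
   again maximal, being the annihilator of a nonzero element of R/m. *)
Lemma jacobson_mulr a r : J a -> J (a * r).
Proof.
move=> Ja m m_max; have [subm mT mM] := m_max.
have mulm b x : m x -> m (b * x) by apply: (submodZ subm).
have [mr|mr] := pselect (m r); first exact: mulm.
apply: (Ja [set b : R^o | m (b * r)]); split.
- apply/submoduleP; split=> [|b u v mu mv] /=.
    by rewrite mul0r; apply: (submod0 subm).
  rewrite mulrDl -mulrA; apply: (submodD subm) => //; exact: mulm.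
- move=> E; apply: mr; rewrite -[r]mul1r.
  by have : [set: R^o] 1 by []; rewrite -E.
move=> B subB mB; have [BE|BE] := pselect (B `<=` [set b : R^o | m (b * r)]).
  by left; apply/seteqP.
right; apply/seteqP; split=> // b _.
have [c Bc mcr] : exists2 c, B c & ~ m (c * r).
  apply: contrapT => nB; apply: BE => c Bc; apply: contrapT => mcr.
  by apply: nB; exists c.
have [d md] := maximal_left_ideal_add (b * r) m_max mcr.
have -> : b = (b - d * c) + d * c by rewrite subrK.
apply: (submodD subB); last exact: (submodZ subB).
by apply: mB; rewrite /= mulrBl -mulrA.
Qed.

(** Generators are removed one at a time from a finite family that spans [M] together with [B].
    Modulo the span [B'] of [B] and the other generators, [M] is cyclic on [v ord0]; if [v ord0] is
    nonzero there, its annihilator lies in a maximal left ideal, which the hypothesis forces to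
    contain 1. *)
Lemma nakayama M (B : set M) :
  finitely_generated [set: M] -> submodule B ->
  [set x + b | x in smul J [set: M] & b in B] = setT -> B = setT.
Proof.
move=> /finitely_generatedP[n [v Mv]] subB JMB.
have {Mv} : [set b + w | b in B & w in range (lincomb v)] = setT.
  apply/seteqP; split=> // x _; exists 0; first exact: submod0.
  by exists x; rewrite ?add0r // -Mv.
elim: n v => [|n IHn] v Mv.
  apply/seteqP; split=> // x _.
  have [b Bb [_ [c _ <-] <-]] :
    [set b + w | b in B & w in range (lincomb v)] x by rewrite Mv.
  by rewrite /lincomb big_ord0 addr0.
apply: (IHn (v \o lift ord0)).
set B' := [set b + w | b in B & w in _].
have subB' : submodule B' := submodule_sum subB (submodule_range _).
have BB' : B `<=` B'.
  move=> b Bb; exists b => //; exists 0; last by rewrite addr0.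
  by exists 0; rewrite ?linear0.
have MB' x : exists c : R, B' (x - c *: v ord0).
  have [b Bb [_ [c _ <-] <-]] :
    [set b + w | b in B & w in range (lincomb v)] x by rewrite Mv.
  exists (c 0 ord0), b => //.
  exists (lincomb (v \o lift ord0) (\row_i c 0 (lift ord0 i))).
    by exists (\row_i c 0 (lift ord0 i)).
  rewrite /lincomb big_ord_recl -addrA [_ + _ - _]addrAC subrr add0r.
  by congr (_ + _); apply: eq_bigr => i _; rewrite mxE.
have vE c x : B' (c *: v ord0) -> B' (x - c *: v ord0) -> B' x.
  by move=> B'v B'x; rewrite -[x](subrK (c *: v ord0)); apply: submodD.
suff B'v0 : B' (v ord0).
  apply/seteqP; split=> // x _; have [c B'x] := MB' x.
  by apply: vE B'x; apply: submodZ.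
apply: contrapT => nB'v0.
have [||m [m_max Im m1]] := @maximal_left_ideal_exists
  [set c : R^o | B' (c *: v ord0)].
- apply/submoduleP; split=> [|a c d] /=.
    by rewrite scale0r; apply: submod0.
  rewrite scalerDl -scalerA => B'c B'd; apply: submodD => //; exact: submodZ.
- by rewrite /= scale1r.
have [subm _ _] := m_max.
have [_ [k [a [w [Ja _ ->]]] [b Bb v0E]]] :
  [set x + b | x in smul J [set: M] & b in B] (v ord0) by rewrite JMB.
have /choice[r rP] : forall i, exists r, B' (w i - r *: v ord0).
  by move=> i; have [r ?] := MB' (w i); exists r.
(* The coefficient [a i * r i] stays in [J] because [J] is also a right ideal. *)
have mJ : m (\sum_(i < k) a i * r i).
  elim/big_ind: _ => [|x y|i _]; first exact: (submod0 subm).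
    exact: (submodD subm).
  exact: jacobson_mulr.
(* Modulo [B'], [v ord0] equals the sum of the [a i * r i] times [v ord0], so 1 minus that sum
   annihilates it and lies in [m]. *)
apply: m1; rewrite -[1](subrK (\sum_(i < k) a i * r i)).
apply: (submodD subm) => //; apply: Im; rewrite /= scalerBl scale1r.
rewrite -{1}v0E addrAC scaler_suml -sumrB.
apply: submodD => //; last exact: BB'.
under eq_bigr => i _ do rewrite -scalerA -scalerBr.
exact: submod_sum.
Qed.

End Radical.

(** * Projective covers: radical kernels, finite generation and uniqueness *)

Section ProjectiveCovers.
Variable R : nzRingType.
Implicit Types K M N P Q X : lmodType R.
Local Notation J := (jacobson R).

Lemma projective_dual_basis P :
  projective P -> finitely_generated [set: P] ->
  exists n (e : 'I_n -> P) (l : {linear P -> 'rV[R]_n}), cancel l (lincomb e).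
Proof.
move=> projP /finitely_generatedP[n [e Pe]].
by have [l lK] := projP _ _ (lincomb e) idfun (esym Pe); exists n, e, l.
Qed.

(** Submodules are sets, so projectivity cannot be applied to [B] directly. Instead, preimages in
    [B] are chosen for the values of [h] at a finite dual basis of [P]; combining them with the
    coordinates gives a linear lift. *)
Lemma projective_lift P M N (g : {linear M -> N}) (B : set M)
    (h : {linear P -> N}) :
  projective P -> finitely_generated [set: P] -> submodule B ->
  (forall x, (g @` B) (h x)) ->
  exists l : {linear P -> M}, (forall x, B (l x)) /\ (forall x, g (l x) = h x).
Proof.
move=> projP fgP subB gB.
have [n [e [l lK]]] := projective_dual_basis projP fgP.
have /choice[b bP] : forall i, exists b, B b /\ g b = h (e i).
  by move=> i; have [b Bb <-] := gB (e i); exists b.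
exists (lincomb b \o l); split=> x /=.
  by apply: submod_sum => // i; case: (bP i).
rewrite -[in RHS](lK x) !linear_sum; apply: eq_bigr => i _.
by rewrite !linearZ /=; case: (bP i) => _ ->.
Qed.

Lemma projective_pair P Q :
  projective P -> projective Q -> projective (P * Q)%type.
Proof.
move=> projP projQ M N g h gT.
have [l lE] := projP _ _ g (h \o inl_mod) gT.
have [m mE] := projQ _ _ g (h \o inr_mod) gT.
exists (copair l m) => -[x y] /=; rewrite /copair linearD /=.
have /= -> := lE x; have /= -> := mE y; rewrite -linearD.
by congr (h _); congr pair; rewrite /= ?addr0 ?add0r.
Qed.

(** If a dual-basis coordinate of some [x] in [A] missed a maximal left ideal [m], the elements
    whose coordinate lies in [m] would form a submodule [S] with [A + S = P]. Then [S = P], although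
    [x] is not in [S]. *)
Lemma superfluous_sub_smul_jacobson P (A : set P) :
  projective P -> finitely_generated [set: P] -> submodule A ->
  superfluous A -> A `<=` smul J setT.
Proof.
move=> projP fgP subA supA x Ax.
have [n [e [l lK]]] := projective_dual_basis projP fgP.
rewrite -[x]lK; exists n, (l x 0), e; split=> // i m m_max.
have [subm mT mM] := m_max.
apply: contrapT => mx.
pose S : set P := [set y | m (l y 0 i)].
have subS : submodule S.
  apply/submoduleP; rewrite /S /=; split=> [|a u v].
    by rewrite linear0 mxE; apply: (submod0 subm).
  rewrite linearP !mxE => mu mv; apply: (submodD subm) => //.
  exact: (submodZ subm).
suff ST : S = setT by apply: mx; have : S x by rewrite ST.
apply: supA => //; apply/seteqP; split=> // y _.
have [c mc] := maximal_left_ideal_add (l y 0 i) m_max mx.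
exists (c *: x); first exact: submodZ.
exists (y - c *: x); last by rewrite addrC subrK.
by rewrite /S /= linearB linearZ !mxE.
Qed.

Lemma superfluous_smul_jacobson M (A : set M) :
  finitely_generated [set: M] -> A `<=` smul J setT -> superfluous A.
Proof.
move=> fgM AJ B subB ABT; apply: nakayama => //.
apply/seteqP; split=> // x _.
have [a Aa [b Bb <-]] : [set a + b | a in A & b in B] x by rewrite ABT.
by exists a; [apply: AJ|exists b].
Qed.

Lemma projective_cover_fg P M (p : {linear P -> M}) (A : set M) :
  projective_cover_onto p A -> finitely_generated A ->
  finitely_generated [set: P].
Proof.
move=> [_ pA supP] /finitely_generatedP[n [v AE]].
have /choice[w wE] : forall c : 'rV[R]_n, exists x, p x = lincomb v c.
  move=> c; have [x _ xE] : range p (lincomb v c) by rewrite pA AE; exists c.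
  by exists x.
have /choice[u uE] : forall i, exists x, p x = v i.
  move=> i; exists (w (delta_mx 0 i)); rewrite wE /lincomb (bigD1 i) //=.
  rewrite mxE !eqxx scale1r big1 ?addr0 // => j ji.
  by rewrite mxE (negbTE ji) andbF scale0r.
apply/finitely_generatedP; exists n, u; apply/esym/supP.
  exact: submodule_range.
apply/seteqP; split=> // x _.
have [c _ cE] : range (lincomb v) (p x) by rewrite -AE -pA; exists x.
exists (x - lincomb u c).
  rewrite /ker /preimage /= linearB -cE linear_sum; apply/eqP; rewrite subr_eq0.
  by apply/eqP; apply: eq_bigr => i _; rewrite linearZ /= uE.
by exists (lincomb u c); [exists c|rewrite subrK].
Qed.

Lemma projective_cover_ker P M (p : {linear P -> M}) (A : set M) :
  projective_cover_onto p A -> finitely_generated [set: P] ->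
  ker p `<=` smul J setT.
Proof.
move=> [projP _ supP] fgP; apply: superfluous_sub_smul_jacobson => //.
exact: submodule_ker.
Qed.

(** An isomorphism of pairs, module and submodule: ambient modules must match as well, since the
    Koszul condition compares a syzygy with [smul I setT]. *)
Definition carries M N (phi : {linear M -> N}) (A : set M) (B : set N) : Prop :=
  [/\ injective phi, range phi = setT & phi @` A = B].

Lemma carries_id M (A : set M) : carries (idfun : {linear M -> M}) A A.
Proof.
split=> //; first by apply/seteqP; split=> // x _; exists x.
by apply/seteqP; split=> [_ [x Ax <-]|x Ax] //; exists x.
Qed.

Lemma projective_cover_unique P P' M M' (p : {linear P -> M})
    (p' : {linear P' -> M'}) (A : set M) (A' : set M')
    (theta : {linear M -> M'}) :
  projective_cover_onto p A -> projective_cover_onto p' A' ->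
  finitely_generated [set: P] -> carries theta A A' ->
  exists phi : {linear P -> P'}, carries phi (ker p) (ker p').
Proof.
move=> [projP pA supP] [projP' p'A' supP'] fgP [theta_inj thetaT thetaA].
have [|phi [_ phiE]] := @projective_lift _ _ _ p' setT (theta \o p)
    projP fgP (submoduleT _).
  by move=> x; rewrite p'A' -thetaA -pA; exists (p x) => //; exists x.
have phi_ker x : ker p' (phi x) -> ker p x.
  rewrite /ker /preimage /= phiE /= => E; apply: theta_inj.
  by rewrite linear0.
have phiT : range phi = setT.
  apply: supP'; first exact: submodule_range.
  apply/seteqP; split=> // y _.
  have [_ [x _ <-] xE] : (theta @` range p) (p' y).
    by rewrite pA thetaA -p'A'; exists y.
  exists (y - phi x); last by exists (phi x); [exists x|rewrite subrK].
  by rewrite /ker /preimage /= linearB phiE /= xE subrr.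
have [sigma sigmaK] := projP' _ _ phi idfun phiT.
have sigmaT : range sigma = setT.
  apply: supP; first exact: submodule_range.
  apply/seteqP; split=> // x _.
  exists (x - sigma (phi x)).
    apply: phi_ker; rewrite linearB; have /= -> := sigmaK (phi x).
    by rewrite subrr; apply: submod0; apply: submodule_ker.
  by exists (sigma (phi x)); [exists (phi x)|rewrite subrK].
exists phi; split=> //.
  move=> x y; have [a _ <-] : range sigma x by rewrite sigmaT.
  have [b _ <-] : range sigma y by rewrite sigmaT.
  by have /= -> := sigmaK a; have /= -> := sigmaK b => ->.
apply/seteqP; split=> [_ [x px <-]|y p'y].
  by move: px; rewrite /ker /preimage /= phiE /= => ->; rewrite linear0.
have [x _ xE] : range phi y by rewrite phiT.
by exists x => //; apply: phi_ker; rewrite xE.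
Qed.

Lemma carries_smul_cap M N (phi : {linear M -> N}) (A : set M) (B : set N)
    (I : set R) :
  carries phi A B ->
  smul J B = B `&` smul I setT -> smul J A = A `&` smul I setT.
Proof.
move=> [phi_inj phiT phiA] BE.
have phi_smul S C x : smul S C x <-> smul S (phi @` C) (phi x).
  rewrite -image_smul; split=> [Cx|[y Cy /phi_inj <- //]]; by exists x.
apply/seteqP; split=> x.
  move=> /phi_smul; rewrite phiA BE -phiA => -[[y Ay /phi_inj <-]].
  by rewrite -phiT => /phi_smul.
move=> [Ax /phi_smul]; rewrite phiT => Ix; apply/phi_smul; rewrite phiA BE.
by split=> //; rewrite -phiA; exists x.
Qed.

End ProjectiveCovers.

(** * The horseshoe construction and its converse *)

Section Horseshoe.
Variable R : nzRingType.
Hypothesis noethR : noetherian R.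
Implicit Types K M N P Q L : lmodType R.
Local Notation J := (jacobson R).

Lemma short_exact_pair P Q :
  short_exact (@inl_mod R P Q) (snd : {linear (P * Q)%type -> Q}).
Proof.
split=> [x y [] //||].
  apply/seteqP; split=> [_ [x _ <-] //|[x y]].
  by rewrite /ker /preimage /= => ->; exists x.
by apply/seteqP; split=> // y _; exists (0, y).
Qed.

(** The inclusion is split by [fst], and linear maps preserve products with [I]. *)
Lemma smul_inl_mod P Q (I : set R) :
  smul I [set: P] = inl_mod @^-1` smul I [set: (P * Q)%type].
Proof.
apply/seteqP; split=> x; first exact: linear_smul.
by move=> /(linear_smul (f := fst) (B := setT)); apply.
Qed.

Lemma horseshoe_cover K M N P Q (f : {linear K -> M}) (g : {linear M -> N})
    (A : set K) (B : set M) (C : set N)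
    (p : {linear P -> K}) (q : {linear Q -> N}) :
  short_exact f g -> submodule B -> A = f @^-1` B -> g @` B = C ->
  smul J A = f @^-1` smul J B ->
  projective_cover_onto p A -> projective_cover_onto q C ->
  finitely_generated [set: P] -> finitely_generated [set: Q] ->
  exists t : {linear (P * Q)%type -> M},
    [/\ projective_cover_onto t B, forall x, t (inl_mod x) = f (p x) &
        forall x, g (t x) = q x.2].
Proof.
move=> [f_inj fgE gT] subB AE gB JA pcov qcov fgP fgQ.
have [projP pA supP] := pcov; have [projQ qC supQ] := qcov.
have gf x : g (f x) = 0 by have : ker g (f x) by rewrite -fgE; exists x.
have [x|h [hB hE]] := projective_lift (g := g) (B := B) (h := q) projQ fgQ subB.
  by rewrite gB -qC; exists x.
have Bfp x : B (f (p x)).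
  by have : A (p x) by [rewrite -pA; exists x]; rewrite AE.
exists (copair (f \o p) h); split=> [|x|x]; last 2 first.
- by rewrite /= /copair /= linear0 addr0.
- by rewrite /= /copair linearD hE /= gf add0r.
split; first exact: projective_pair.
  apply/seteqP; split=> [_ [[x y] _ <-]|m Bm].
    by apply: submodD => //=.
  have [y _ yE] : range q (g m) by rewrite qC -gB; exists m.
  have [k _ kE] : range f (m - h y).
    by rewrite fgE /ker /preimage /= linearB hE yE subrr.
  have [x _ xE] : range p k.
    by rewrite pA AE /preimage /= kE; apply: submodB.
  by exists (x, y) => //; rewrite /= /copair /= xE kE subrK.
apply: superfluous_smul_jacobson; first exact: finitely_generated_pair.
move=> [x y] xyt; have txy : f (p x) + h y = 0 := xyt.
have qy : ker q y.
  rewrite /ker /preimage /= -hE -[g (h y)]add0r -(gf (p x)).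
  by rewrite -linearD txy linear0.
have Jy : smul J setT y by apply: projective_cover_ker qcov fgQ _ qy.
(* As [f (p x) = - h y] with [y] in [J Q] and [h] valued in [B], it lies in [J B]; the hypothesis
   then puts [p x] in [J A]. *)
have : smul J A (p x).
  rewrite JA /preimage /=; have -> : f (p x) = h (- y).
    by rewrite linearN; apply/eqP; rewrite -addr_eq0 txy.
  apply: (linear_smul (A := setT)) => //; exact/smulN/Jy/submoduleT.
rewrite -pA -image_smul => -[x' Jx' px'].
(* [x] differs from some [x'] in [J P] by an element of [ker p], itself inside [J P]. *)
have Jx : smul J setT x.
  rewrite -[x](subrK x'); apply: smulD => //.
  apply: (projective_cover_ker pcov fgP).
  by rewrite /ker /preimage /= linearB px' subrr.
have -> : (x, y) = inl_mod x + inr_mod y.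
  by congr pair; rewrite /= ?addr0 ?add0r.
by apply: smulD; apply: (linear_smul (A := setT)).
Qed.

(* One step of the induction: A, B, C are the n-th syzygies of K, M, N, and A',
   B' are those of the resolutions witnessing that K and M are Koszul. *)
Definition horseshoe_stage K M N K' M' (f : {linear K -> M})
    (g : {linear M -> N}) (A : set K) (B : set M) (C : set N)
    (A' : set K') (B' : set M') : Prop :=
  [/\ submodule B, A = f @^-1` B, g @` B = C, smul J A = f @^-1` smul J B &
      (exists theta : {linear K -> K'}, carries theta A A') /\
      (exists eta : {linear M -> M'}, carries eta B B')].

Lemma horseshoe_stage_next K M N K' M' P Q P' L'
    (f : {linear K -> M}) (g : {linear M -> N}) A B C A' B'
    (p : {linear P -> K}) (q : {linear Q -> N})
    (p' : {linear P' -> K'}) (l' : {linear L' -> M'}) (I : set R) :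
  short_exact f g -> horseshoe_stage f g A B C A' B' ->
  projective_cover_onto p A -> projective_cover_onto q C ->
  finitely_generated [set: P] -> finitely_generated [set: Q] ->
  projective_cover_onto p' A' -> projective_cover_onto l' B' ->
  smul J (ker p') = ker p' `&` smul I setT ->
  smul J (ker l') = ker l' `&` smul I setT ->
  exists t : {linear (P * Q)%type -> M},
    [/\ projective_cover_onto t B, forall x, t (inl_mod x) = f (p x),
        forall x, g (t x) = q x.2 &
        horseshoe_stage inl_mod snd (ker p) (ker t) (ker q) (ker p') (ker l')].
Proof.
move=> fg_ex [subB AE gB JA [[theta thetaA] [eta etaB]]] pcov qcov fgP fgQ.
move=> p'cov l'cov Kp' Kl'.
have [t [tcov tl tr]] := horseshoe_cover fg_ex subB AE gB JA pcov qcov fgP fgQ.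
have [phi phiE] := projective_cover_unique pcov p'cov fgP thetaA.
have [psi psiE] := projective_cover_unique tcov l'cov
  (finitely_generated_pair fgP fgQ) etaB.
have [f_inj fgE _] := fg_ex.
have kerp : ker p = inl_mod @^-1` ker t.
  apply/seteqP; split=> x; rewrite /ker /preimage /= tl.
    by move=> ->; rewrite linear0.
  by move=> E; apply: f_inj; rewrite E linear0.
exists t; split=> //; split.
- exact: submodule_ker.
- exact: kerp.
- apply/seteqP; split=> [_ [x tx <-]|y qy].
    by rewrite /ker /preimage /= -tr tx linear0.
  (* The lift [inr_mod y] need not be in [ker t]; its image comes from [A], so an element of [P] can
     be subtracted to correct it. *)
  have [k _ kE] : range f (t (inr_mod y)).
    by rewrite fgE /ker /preimage /= tr.
  have [x _ xE] : range p k.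
    case: pcov => _ -> _; rewrite AE /preimage /= kE.
    by case: tcov => _ <- _; eexists.
  exists (inr_mod y - inl_mod x); last by rewrite /= subr0.
  by rewrite /ker /preimage /= linearB tl xE kE subrr.
(* With the same [I] on both sides, the two transported Koszul conditions differ only in the ambient
   module, and [I P] is the trace on [P] of [I (P + Q)]. *)
- rewrite (carries_smul_cap phiE Kp') (carries_smul_cap psiE Kl').
  by rewrite kerp preimage_setI -smul_inl_mod.
- by split; [exists phi|exists psi].
Qed.

(** Dependent choice along a family of types, as the syzygy under construction lives in a different
    module at each degree. The recursion carries the proof of [good] with the value. *)
Lemma dependent_choice_rel (T : nat -> Type) (good : forall n, T n -> Prop)
    (next : forall n, T n -> T n.+1 -> Prop) (x0 : T 0%N) :
  good 0%N x0 ->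
  (forall n x, good n x -> exists y, next n x y /\ good n.+1 y) ->
  exists2 s : forall n, T n, s 0%N = x0 &
    forall n, good n (s n) /\ next n (s n) (s n.+1).
Proof.
move=> good0 step.
pose F := nat_rect (fun n => {x : T n | good n x}) (exist _ x0 good0)
  (fun n x => let y := cid (step n (sval x) (svalP x)) in
              exist _ (sval y) (proj2 (svalP y))).
exists (fun n => sval (F n)) => // n; split; first exact: svalP.
by rewrite /=; case: (cid _) => y [].
Qed.

(** The Noetherian hypothesis makes each syzygy finitely generated, and covers inherit finite
    generation. *)
Lemma minimal_resolution_fg M (P : augmented_sequence M) n :
  finitely_generated [set: M] -> minimal_resolution P ->
  finitely_generated [set: term P n].
Proof.
move=> fgM [cov0 cov]; elim: n => [|n IHn].
  exact: projective_cover_fg cov0 fgM.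
apply: (projective_cover_fg (cov n)).
apply: finitely_generated_submodule => //.
by case: (n) => [|m]; apply: submodule_ker.
Qed.

Lemma minimal_horseshoe_radical K M N (f : {linear K -> M})
    (g : {linear M -> N}) (P : augmented_sequence K)
    (Q : augmented_sequence N) :
  short_exact f g -> finitely_generated [set: M] ->
  minimal_resolution P -> minimal_resolution Q -> minimal_horseshoe f g ->
  f @` smul J [set: K] = range f `&` smul J [set: M].
Proof.
move=> [f_inj fgE gT] fgM Pmin Qmin /(_ P Q Pmin Qmin).
move=> [L [Lmin [i [q [ex _ _ iE qE]]]]].
have [i_inj iqE qT] := ex 0%N.
have [[_ augPT _] _] := Pmin; have [[projQ _ _] _] := Qmin.
have [Lcov _] := Lmin; have [_ augLT _] := Lcov.
have fgL := minimal_resolution_fg 0 fgM Lmin.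
apply/seteqP; split=> [_ [x Jx <-]|m].
  by split; [exists x|apply: linear_smul Jx].
rewrite -augLT -image_smul => -[[x _ <-] [y Jy yE]].
have [w _ wE] : range (aug P) x by rewrite augPT.
have Jz : smul J setT (y - i 0%N w).
  apply: (projective_cover_ker Lcov fgL); rewrite /ker /preimage /= linearB yE.
  by have /= <- := iE w; rewrite wE subrr.
(* [y] and [i 0%N w] both lift [f x], and their difference lies in the kernel of the cover, hence in
   the radical. *)
have Jiw : smul J setT (i 0%N w).
  rewrite -[i 0%N w](subrK y) addrC -opprB.
  by apply: smulB => //; apply: submoduleT.
have [s sK] := projQ _ _ (q 0%N) idfun qT.
have qi u : q 0%N (i 0%N u) = 0.
  by have : ker (q 0%N) (i 0%N u) by rewrite -iqE; exists u.
have : smul J (range (i 0%N)) (i 0%N w).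
  (* The projection [1 - s q_0] of [L_0] onto the range of [i_0] fixes [i 0%N w], so it shows that
     this element is in [J] times that range. *)
  pose r : {linear _ -> _} := idfun \- (s \o q 0%N).
  have -> : i 0%N w = r (i 0%N w) by rewrite /= qi linear0 subr0.
  apply: (linear_smul (f := r) (A := setT)) Jiw => u _.
  rewrite iqE /ker /preimage /= linearB.
  by have /= -> := sK (q 0%N u); rewrite subrr.
rewrite -image_smul => -[w' Jw' /i_inj w'E].
by exists x => //; rewrite -wE -w'E; apply: linear_smul Jw'.
Qed.

Lemma quasi_delta_koszul_horseshoe (delta : nat -> nat) K M N
    (f : {linear K -> M}) (g : {linear M -> N}) :
  short_exact f g -> quasi_delta_koszul delta K -> quasi_delta_koszul delta M ->
  finitely_generated [set: N] ->
  f @` smul J [set: K] = range f `&` smul J [set: M] -> minimal_horseshoe f g.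
Proof.
move=> fg_ex [fgK [P' [P'min P'E]]] [fgM [L' [L'min L'E]]] fgN JK P Q Pmin Qmin.
have [f_inj fgE gT] := fg_ex.
have [Pcov0 Pcov] := Pmin; have [Qcov0 Qcov] := Qmin.
have [P'cov0 P'cov] := P'min; have [L'cov0 L'cov] := L'min.
have fgP n := minimal_resolution_fg n fgK Pmin.
have fgQ n := minimal_resolution_fg n fgN Qmin.
(* In degree -1 the syzygies are [K], [M] and [N] themselves, and the radical condition is the
   hypothesis [JK]. *)
have stage0 : horseshoe_stage f g setT setT setT [set: K] [set: M].
  split=> //; first exact: submoduleT;
    last by split; exists idfun; apply: carries_id.
  apply/seteqP; split=> x /= Jx; first exact: linear_smul Jx.
  have : (f @` smul J setT) (f x) by rewrite JK; split=> //; exists x.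
  by case=> y Jy /f_inj <-.
have [|t0 [t0cov t0P t0Q stage1]] := horseshoe_stage_next (p := aug P)
  (q := aug Q) (p' := aug P') (l' := aug L') fg_ex stage0 Pcov0 Qcov0 (fgP 0%N)
  (fgQ 0%N) P'cov0 L'cov0 (proj2 (P'E 0%N)); first exact: (proj2 (L'E 0%N)).
(* From here on the ambient sequences are the split ones in [T n]. The state in degree [n] is only
   the syzygy [B] of the middle term; the differential is recorded existentially in [next] and
   chosen afterwards. *)
pose T n : lmodType R := (term P n * term Q n)%type.
pose stage n (B : set (T n)) :=
  horseshoe_stage (@inl_mod R (term P n) (term Q n))
  (snd : {linear _ -> term Q n}) (syzygy P n) B (syzygy Q n)
  (syzygy P' n) (syzygy L' n).
pose next n (B : set (T n)) (B' : set (T n.+1)) :=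
  exists t : {linear T n.+1 -> T n},
    [/\ projective_cover_onto t B,
        forall x, t (inl_mod x) = inl_mod (diff P n x),
        forall x, (t x).2 = diff Q n x.2 & B' = ker t].
have step n (B : set (T n)) :
    stage n B -> exists B', next n B B' /\ stage n.+1 B'.
  move=> stageB.
  have [|t [tcov tP tQ stageS]] := horseshoe_stage_next (p := diff P n)
    (q := diff Q n) (p' := diff P' n) (l' := diff L' n) (short_exact_pair _ _)
    stageB (Pcov n) (Qcov n) (fgP n.+1) (fgQ n.+1) (P'cov n) (L'cov n)
    (proj2 (P'E n.+1)); first exact: (proj2 (L'E n.+1)).
  by exists (ker t); split=> //; exists t.
have [B B0 BE] := dependent_choice_rel stage1 step.
pose t n := sval (cid (proj2 (BE n))).
have tE n : [/\ projective_cover_onto (t n) (B n),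
    forall x, t n (inl_mod x) = inl_mod (diff P n x),
    forall x, (t n x).2 = diff Q n x.2 & B n.+1 = ker (t n)].
  exact: svalP (cid (proj2 (BE n))).
pose L := AugmentedSequence t t0.
have BL n : B n = syzygy L n by case: n => [|n]; rewrite ?B0 //; case: (tE n).
exists L; split.
  by split=> // n; rewrite -BL; case: (tE n).
exists (fun n => inl_mod), (fun n => snd); split=> [n|n x|n x|x|x] //=.
- exact: short_exact_pair.
- by case: (tE n) => _ ->.
- by case: (tE n) => _ _ ->.
Qed.

(** All three categories of the theorem are instances of one [delta]. *)
Theorem quasi_delta_koszul_horseshoe_iff (delta : nat -> nat) K M N
    (f : {linear K -> M}) (g : {linear M -> N}) :
  short_exact f g -> quasi_delta_koszul delta K ->
  quasi_delta_koszul delta M -> quasi_delta_koszul delta N ->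
  f @` smul J [set: K] = range f `&` smul J [set: M] <-> minimal_horseshoe f g.
Proof.
move=> fg_ex koszulK koszulM koszulN; split.
  by case: koszulN => fgN _; apply: quasi_delta_koszul_horseshoe koszulM fgN.
(* [minimal_horseshoe] quantifies over given resolutions, so some must exist; the Koszul conditions
   on [K] and [N] provide them. *)
have [[_ [P [Pmin _]]] [_ [Q [Qmin _]]]] := (koszulK, koszulN).
by case: koszulM => fgM _; apply: minimal_horseshoe_radical Pmin Qmin.
Qed.

End Horseshoe.

Theorem corollaryB (k : fieldType) (R : algType k)
    (R_augmented : augmented R) (R_noetherian : noetherian R)
    (R_semiperfect : semiperfect R)
    (K M N : lmodType R) (f : {linear K -> M}) (g : {linear M -> N})
    (xi : short_exact f g) :
  [/\ quasi_koszul K -> quasi_koszul M -> quasi_koszul N ->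
        (f @` smul (jacobson R) [set: K]
           = range f `&` smul (jacobson R) [set: M]
         <-> minimal_horseshoe f g),
      forall d : nat, (2 <= d)%N ->
        quasi_d_koszul d K -> quasi_d_koszul d M -> quasi_d_koszul d N ->
        (f @` smul (jacobson R) [set: K]
           = range f `&` smul (jacobson R) [set: M]
         <-> minimal_horseshoe f g) &
      forall p d : nat, (2 <= p <= d)%N ->
        quasi_piecewise_koszul p d K -> quasi_piecewise_koszul p d M ->
        quasi_piecewise_koszul p d N ->
        (f @` smul (jacobson R) [set: K]
           = range f `&` smul (jacobson R) [set: M]
         <-> minimal_horseshoe f g)].
Proof.
by split=> [|d _|p d _]; apply: quasi_delta_koszul_horseshoe_iff.
Qed.
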